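(* Let $R$ be a commutative ring with identity, $S\subseteq R$ a multiplicative set, and $J$ an ideal of $R$. If $R$ is $S$-$J$-Noetherian, then every proper $J$-ideal of $R$ disjoint from $S$ can be written as a finite intersection of $S$-primary ideals of $R$.
   Context: A multiplicative set $S\subseteq R$ is a subset containing $1$ and closed under multiplication. An ideal $I$ of $R$ is called $S$-finite if there exist $s\in S$ and a finitely generated ideal $F$ of $R$ such that $sI\subseteq F\subseteq I$. An ideal $I$ of $R$ is called a $J$-ideal if $I\nsubseteq J$. The ring $R$ is called $S$-$J$-Noetherian if every $J$-ideal of $R$ is $S$-finite. A proper ideal $Q$ of $R$ disjoint from $S$ is called $S$-primary if there exists $s\in S$ such that for all $a,b\in R$, if $ab\in Q$, then $sa\in Q$ or $sb\in \mathrm{rad}(Q)$, where $\mathrm{rad}(Q)$ is the radical of $Q$. *)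

(* Defs.v *)
From mathcomp Require Import all_boot all_algebra.
From mathcomp Require Import boolp classical_sets.

Set Implicit Arguments.
Unset Strict Implicit.
Unset Printing Implicit Defensive.

Import GRing.Theory.
Local Open Scope ring_scope.
Local Open Scope classical_set_scope.

Definition multiplicative_set (R : comPzRingType) (S : set R) : Prop :=
  GRing.mulr_closed [in S].

(* The ideals of R are the submodules of the regular module R^o. The [idealr]
   structure of ring_quotient is not used: it only covers proper ideals, of
   nontrivial rings. *)
Definition is_ideal (R : comPzRingType) (I : set R) : Prop :=
  @GRing.submod_closed R R^o [in I].

Definition ideal_span (R : comPzRingType) (A : set R) : set R :=
  smallest (@is_ideal R) A.

Definition fin_gen_ideal (R : comPzRingType) (F : set R) : Prop :=
  exists l : seq R, F = ideal_span [set` l].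

Definition S_finite (R : comPzRingType) (S I : set R) : Prop :=
  exists2 s : R, S s &
    exists F : set R,
      [/\ fin_gen_ideal F, [set s * x | x in I] `<=` F & F `<=` I].

Definition J_ideal (R : comPzRingType) (J I : set R) : Prop :=
  is_ideal I /\ ~ (I `<=` J).

Definition S_J_Noetherian (R : comPzRingType) (S J : set R) : Prop :=
  forall I : set R, J_ideal J I -> S_finite S I.

Definition rad (R : comPzRingType) (Q : set R) : set R :=
  [set x | exists2 n : nat, (0 < n)%N & Q (x ^+ n)].

Definition S_primary (R : comPzRingType) (S Q : set R) : Prop :=
  [/\ is_ideal Q, Q <> [set: R], Q `&` S = set0 &
    exists2 s : R, S s &
      forall a b : R, Q (a * b) -> Q (s * a) \/ rad Q (s * b)].

(* Main.v *)
Require Import Defs.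
From mathcomp Require Import all_boot all_algebra.
From mathcomp Require Import boolp classical_sets.

(** Every ideal containing a J-ideal I is again a J-ideal, so it is S-finite:
    only the S-finiteness of the ideals above I matters.

    Call an ideal K saturated if t * x in K with t in S forces x in K. If
    t U <= F <= U with F finitely generated, then a saturated K that contains
    the generators of F contains U; hence the saturated ideals above I satisfy
    the ascending chain condition ([saturated_acc]), and the classical
    Lasker-Noether argument can be run among them
    ([saturated_primary_decomposition]): they are the ideals contracted from
    the localization at S.

    It remains to go from the saturation of I back to I. By S-finiteness some
    s in S carries the saturation into I ([saturation_sub_colon]), and then I is
    the intersection of its saturation with I + sR. The ideal I + sR meets S, so
    it cannot be used as a component; but if Q is primary and disjoint from S,
    then Q meet (I + sR) is S-primary with witness s, because multiplication by
    s sends Q into it ([S_primary_trunc]). Replacing every component Q of the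
    saturation by Q meet (I + sR) gives the decomposition of I. *)

Set Implicit Arguments.
Unset Strict Implicit.
Unset Printing Implicit Defensive.

Import GRing.Theory Defs.
Local Open Scope ring_scope.
Local Open Scope classical_set_scope.

(** * Ideals *)

Lemma is_idealP {R : comPzRingType} (K : set R) :
  is_ideal K <-> [/\ K 0, forall x y, K x -> K y -> K (x + y)
                   & forall a x, K x -> K (a * x)].
Proof.
split=> [[K0 KL]|[K0 KD KM]].
  have L a x y : K x -> K y -> K (a * x + y).
    by move=> Kx Ky; have := KL a x y; rewrite !inE; apply.
  have {}K0 : K 0 by move: K0; rewrite inE.
  split=> // [x y Kx Ky|a x Kx]; first by rewrite -[x]mul1r; apply: L.
  by rewrite -[_ * _]addr0; apply: L.
split; first by rewrite inE.
by move=> a x y; rewrite !inE => Kx Ky; apply: KD => //; apply: KM.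
Qed.

Lemma multiplicative_setP {R : comPzRingType} (S : set R) :
  multiplicative_set S -> S 1 /\ forall s t, S s -> S t -> S (s * t).
Proof.
case=> S1 SM; split=> [|s t Ss St]; first by move: S1; rewrite inE.
by have := SM s t; rewrite !inE; apply.
Qed.

Lemma ideal_sub_opp {R : comPzRingType} (K : set R) (x y : R) :
  is_ideal K -> K (x + y) -> K x -> K y.
Proof.
move=> /is_idealP[_ KD KM] Kxy Kx; have := KD _ _ Kxy (KM (-1) _ Kx).
by rewrite mulN1r addrAC subrr add0r.
Qed.

Definition colon {R : comPzRingType} (K : set R) (a : R) : set R :=
  [set x | K (a * x)].

Lemma colon_ideal {R : comPzRingType} (K : set R) (a : R) :
  is_ideal K -> is_ideal (colon K a).
Proof.
move=> /is_idealP[K0 KD KM]; apply/is_idealP; split=> [|x y Kx Ky|b x Kx].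
- by rewrite /colon /= mulr0.
- by rewrite /colon /= mulrDr; apply: KD.
- by rewrite /colon /= mulrCA; apply: KM.
Qed.

Lemma sub_colon {R : comPzRingType} (K : set R) (a : R) :
  is_ideal K -> K `<=` colon K a.
Proof. by move=> /is_idealP[_ _ KM] x; apply: KM. Qed.

Definition adjoin {R : comPzRingType} (K : set R) (a : R) : set R :=
  [set x | exists k r, K k /\ x = k + a * r].

Lemma adjoin_ideal {R : comPzRingType} (K : set R) (a : R) :
  is_ideal K -> is_ideal (adjoin K a).
Proof.
move=> /is_idealP[K0 KD KM]; apply/is_idealP; split.
- by exists 0, 0; rewrite mulr0 addr0.
- move=> _ _ [k [r [Kk ->]]] [k' [r' [Kk' ->]]]; exists (k + k'), (r + r').
  by split; [apply: KD | rewrite mulrDr addrACA].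
- move=> b _ [k [r [Kk ->]]]; exists (b * k), (b * r).
  by split; [apply: KM | rewrite mulrDr (mulrCA b)].
Qed.

Lemma sub_adjoin {R : comPzRingType} (K : set R) (a : R) : K `<=` adjoin K a.
Proof. by move=> x Kx; exists x, 0; rewrite mulr0 addr0. Qed.

Lemma mem_adjoin {R : comPzRingType} (K : set R) (a r : R) :
  is_ideal K -> adjoin K a (a * r).
Proof. by move=> /is_idealP[K0 _ _]; exists 0, r; rewrite add0r. Qed.

(** The splitting step of primary decomposition, for any a such that the
    colon ideals K : a and K : a^2 agree. *)
Lemma colon_cap_adjoin {R : comPzRingType} (K : set R) (a x : R) :
  is_ideal K -> (forall y, K (a * (a * y)) -> K (a * y)) ->
  K (a * x) -> adjoin K a x -> K x.
Proof.
move=> KI stab Kax [k [r [Kk def_x]]]; have /is_idealP[_ KD KM] := KI.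
rewrite def_x; apply: KD => //; apply: stab.
apply: (@ideal_sub_opp _ K (a * k)) => //; last exact: KM.
by rewrite -mulrDr -def_x.
Qed.

(** * Saturated ideals *)

Definition saturation {R : comPzRingType} (S K : set R) : set R :=
  [set x | exists2 t, S t & K (t * x)].

Lemma saturation_ideal {R : comPzRingType} (S K : set R) :
  multiplicative_set S -> is_ideal K -> is_ideal (saturation S K).
Proof.
move=> /multiplicative_setP[S1 SM] /is_idealP[K0 KD KM].
apply/is_idealP; split.
- by exists 1; rewrite ?mulr0.
- move=> x y [t St Kx] [u Su Ky]; exists (t * u); first exact: SM.
  by rewrite mulrDr; apply: KD; [rewrite mulrAC mulrC | rewrite -mulrA];
     apply: KM.
- by move=> a x [t St Kx]; exists t; rewrite // mulrCA; apply: KM.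
Qed.

Lemma sub_saturation {R : comPzRingType} (S K : set R) :
  multiplicative_set S -> K `<=` saturation S K.
Proof. by move=> /multiplicative_setP[S1 _] x Kx; exists 1; rewrite ?mul1r. Qed.

Definition saturated_over {R : comPzRingType} (S I K : set R) : Prop :=
  [/\ is_ideal K, I `<=` K & forall t x, S t -> K (t * x) -> K x].

Lemma saturation_saturated {R : comPzRingType} (S I K : set R) :
  multiplicative_set S -> is_ideal K -> I `<=` K ->
  saturated_over S I (saturation S K).
Proof.
move=> hS KI IK; split; first exact: saturation_ideal.
  by move=> x /IK; apply: sub_saturation.
move=> t x St [u Su]; rewrite mulrA => Kx; exists (u * t) => //.
by case/multiplicative_setP: hS => _; apply.
Qed.

Lemma colon_saturated {R : comPzRingType} (S I K : set R) (a : R) :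
  saturated_over S I K -> saturated_over S I (colon K a).
Proof.
move=> [KI IK Ksat]; split; first exact: colon_ideal.
  by move=> x /IK; apply: sub_colon.
by move=> t x St; rewrite /colon /= mulrCA; apply: Ksat.
Qed.

Lemma chain_finite_sub {T : choiceType} (C : nat -> set T) (l : seq T) :
  (forall m n, (m <= n)%N -> C m `<=` C n) ->
  [set` l] `<=` \bigcup_n C n -> exists n, [set` l] `<=` C n.
Proof.
move=> mono; elim: l => [|x l IHl] sub; first by exists 0%N.
have [y yl|n ln] := IHl; first by apply: sub; rewrite /= inE yl orbT.
have [m _ xm] : (\bigcup_n C n) x by apply: sub; rewrite /= mem_head.
exists (maxn m n) => y; rewrite /= inE => /orP[/eqP->|yl].
  exact: mono (leq_maxl _ _) _ xm.
exact: mono (leq_maxr _ _) _ (ln _ yl).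
Qed.

Lemma ideal_span_sub {R : comPzRingType} (l : seq R) (K : set R) :
  is_ideal K -> [set` l] `<=` K -> ideal_span [set` l] `<=` K.
Proof. by move=> KI lK x; apply. Qed.

Lemma sub_ideal_span {R : comPzRingType} (A : set R) : A `<=` ideal_span A.
Proof. by move=> x Ax K [_]; apply. Qed.

(** Only finitely many generators of the union of the chain matter up to S, and
    a saturated member of the chain does not see elements of S. *)
Lemma saturated_acc {R : comPzRingType} (S I : set R) (C : nat -> set R) :
  (forall K, is_ideal K -> I `<=` K -> S_finite S K) ->
  (forall n, saturated_over S I (C n)) -> (forall n, C n `<=` C n.+1) ->
  exists n, C n.+1 `<=` C n.
Proof.
move=> fin Csat Cincr.
have mono m n : (m <= n)%N -> C m `<=` C n.
  move=> /subnK<-; elim: (n - m)%N => [|k IHk] //.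
  by move=> x /IHk; apply: Cincr.
have UI : is_ideal (\bigcup_n C n).
  apply/is_idealP; split.
  - by exists 0%N => //; case: (Csat 0%N) => /is_idealP[].
  - move=> x y [m _ Cx] [n _ Cy]; exists (maxn m n) => //.
    have [/is_idealP[_ KD _] _ _] := Csat (maxn m n).
    by apply: KD; [apply: mono (leq_maxl _ _) _ Cx
                  | apply: mono (leq_maxr _ _) _ Cy].
  - move=> a x [n _ Cx]; exists n => //.
    by have [/is_idealP[_ _ KM] _ _] := Csat n; apply: KM.
have IU : I `<=` \bigcup_n C n.
  by move=> x Ix; exists 0%N => //; have [_ IC _] := Csat 0%N; apply: IC.
have [s Ss [_ [[l ->] sU lU]]] := fin _ UI IU.
have [n ln] := chain_finite_sub mono (subset_trans (@sub_ideal_span _ _) lU).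
exists n => x Cx; have [CI _ Cs] := Csat n.
apply: (Cs s) => //; apply: (ideal_span_sub CI ln); apply: sU.
by exists x => //; exists n.+1.
Qed.

(** Noetherian induction: dependent choice turns a counterexample into a
    strictly increasing sequence, which [saturated_acc] forbids. *)
Lemma saturated_ind {R : comPzRingType} (S I : set R) (P : set R -> Prop) :
  (forall K, is_ideal K -> I `<=` K -> S_finite S K) ->
  (forall K, saturated_over S I K ->
     (forall L, saturated_over S I L -> K `<=` L -> ~ (L `<=` K) -> P L) ->
     P K) ->
  forall K, saturated_over S I K -> P K.
Proof.
move=> fin step K0 K0sat; apply: contrapT => nPK0.
pose T := {K | saturated_over S I K /\ ~ P K}.
have /choice[f fP] (u : T) : exists v : T,
    projT1 u `<=` projT1 v /\ ~ (projT1 v `<=` projT1 u).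
  case: u => K [Ksat nPK] /=; apply: contrapT => nex; apply: nPK.
  apply: step => // L Lsat KL nLK; apply: contrapT => nPL; apply: nex.
  by exists (exist _ L (conj Lsat nPL)).
pose u0 : T := exist _ K0 (conj K0sat nPK0).
have [n|n|n] := @saturated_acc _ S I (fun n => projT1 (iter n f u0)) fin.
- by case: (projT2 (iter n f u0)).
- by case: (fP (iter n f u0)).
- by case: (fP (iter n f u0)).
Qed.

(** * Primary decomposition of saturated ideals *)

Definition primary {R : comPzRingType} (Q : set R) : Prop :=
  ~ Q 1 /\ forall a b, Q (a * b) -> Q a \/ rad Q b.

(** Lasker-Noether: a failure of primality, a * b in K with a and all powers of
    b outside K, gives a power c of b with K : c = K : c^2, and K is then the
    intersection of K : c and the saturation of K + cR, both strictly larger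
    ([colon_cap_adjoin]). The list is empty for K = R. *)
Lemma saturated_primary_decomposition {R : comPzRingType} (S I : set R) :
  multiplicative_set S ->
  (forall K, is_ideal K -> I `<=` K -> S_finite S K) ->
  forall K, saturated_over S I K ->
  exists l : seq (set R),
    (forall Q, Q \in l -> saturated_over S I Q /\ primary Q) /\
    (forall x, K x <-> forall Q, Q \in l -> Q x).
Proof.
move=> hS fin; apply: saturated_ind (fin) _ => K Ksat IH.
have [KI IK Ks] := Ksat; have /is_idealP[K0 KD KM] := KI.
have [K1|nK1] := pselect (K 1).
  exists [::]; split=> // x; split=> // _.
  by rewrite -[x]mulr1; apply: KM.
have [Kprim|] := pselect (forall a b, K (a * b) -> K a \/ rad K b).
  exists [:: K]; split=> [Q|x]; first by rewrite inE => /eqP->.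
  split=> [Kx Q|]; first by rewrite inE => /eqP->.
  by apply; rewrite mem_head.
move=> /existsNP[a] /existsNP[b] /not_implyP[Kab] /not_orP[nKa nKb].
have incr n : colon K (b ^+ n) `<=` colon K (b ^+ n.+1).
  by move=> x Kx; rewrite /colon /= exprS -mulrA; apply: KM.
have [n Kn] := saturated_acc fin (fun n => colon_saturated (b ^+ n) Ksat) incr.
have stab1 m y : K (b ^+ (n + m) * y) -> K (b ^+ n * y).
  elim: m => [|m IHm]; first by rewrite addn0.
  rewrite addnS -addSn exprD -mulrA => Kn1; apply: IHm.
  by rewrite exprD -mulrA; apply: Kn.
(* the exponent is made positive so that a belongs to the colon ideal *)
pose c := b ^+ n.+1.
have stab y : K (c * (c * y)) -> K (c * y).
  rewrite mulrA -exprD addSnnS => /stab1 Ky.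
  by rewrite /c exprS -mulrA; apply: KM.
have nKc : ~ K c by move=> Kc; apply: nKb; exists n.+1.
have [l1 [l1P l1E]] : exists l : seq (set R),
    (forall Q, Q \in l -> saturated_over S I Q /\ primary Q) /\
    (forall x, colon K c x <-> forall Q, Q \in l -> Q x).
  apply: IH; [exact: colon_saturated | exact: sub_colon |].
  move=> /(_ a) sub; apply: nKa; apply: sub.
  by rewrite /colon /= /c exprSr -mulrA (mulrC b); apply: KM.
have [l2 [l2P l2E]] : exists l : seq (set R),
    (forall Q, Q \in l -> saturated_over S I Q /\ primary Q) /\
    (forall x, saturation S (adjoin K c) x <-> forall Q, Q \in l -> Q x).
  apply: IH.
  - apply: saturation_saturated => //; first exact: adjoin_ideal.
    by move=> x /IK; apply: sub_adjoin.
  - by move=> x Kx; apply: sub_saturation => //; apply: sub_adjoin.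
  - move=> /(_ c) sub; apply: nKc; apply: sub; apply: sub_saturation => //.
    by rewrite -[X in adjoin _ _ X]mulr1; apply: mem_adjoin.
exists (l1 ++ l2); split=> [Q|x].
  by rewrite mem_cat => /orP[/l1P|/l2P].
split=> [Kx Q|lx].
  rewrite mem_cat => /orP[]; first by apply: (proj1 (l1E x)); apply: KM.
  by apply: (proj1 (l2E x)); apply: sub_saturation => //; apply: sub_adjoin.
have /(l1E x) cx : forall Q, Q \in l1 -> Q x.
  by move=> Q Ql; apply: lx; rewrite mem_cat Ql.
have /(l2E x)[t St tx] : forall Q, Q \in l2 -> Q x.
  by move=> Q Ql; apply: lx; rewrite mem_cat Ql orbT.
apply: (Ks t) => //; apply: colon_cap_adjoin tx => //.
by rewrite mulrCA; apply: KM.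
Qed.

(** * From the saturation back to the ideal *)

(** The product of the elements of S that carry finitely many generators of the
    saturation, up to S, into I does this for the whole saturation. *)
Lemma saturation_sub_colon {R : comPzRingType} (S I : set R) :
  multiplicative_set S -> is_ideal I -> S_finite S (saturation S I) ->
  exists2 s, S s & saturation S I `<=` colon I s.
Proof.
move=> hS II [t St [_ [[l ->] tF Fsat]]].
have [S1 SM] := multiplicative_setP hS; have /is_idealP[_ _ IM] := II.
have [p Sp lp] : exists2 p, S p & [set` l] `<=` colon I p.
  have: [set` l] `<=` saturation S I.
    by move=> x xl; apply: Fsat; apply: sub_ideal_span.
  elim: {tF Fsat} l => [|x l IHl] sub; first by exists 1.
  have [y yl|p Sp lp] := IHl; first by apply: sub; rewrite /= inE yl orbT.
  have [u Su Iux] : saturation S I x by apply: sub; rewrite /= mem_head.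
  exists (u * p); first exact: SM.
  move=> y; rewrite /= inE => /orP[/eqP->|/lp Ipy].
    by rewrite /colon /= mulrAC mulrC; apply: IM.
  by rewrite /colon /= -mulrA; apply: IM.
exists (p * t) => [|x Ix]; first exact: SM.
rewrite /colon /= -mulrA; apply: (ideal_span_sub (colon_ideal p II) lp).
by apply: tF; exists x.
Qed.

(** Multiplication by s sends Q into its trace on an ideal L containing s, so
    this trace is S-primary although L meets S. *)
Lemma S_primary_trunc {R : comPzRingType} (S Q L : set R) (s : R) :
  is_ideal Q -> is_ideal L -> primary Q -> Q `&` S = set0 -> S 1 ->
  S s -> L s -> S_primary S (Q `&` L).
Proof.
move=> /is_idealP[Q0 QD QM] /is_idealP[L0 LD LM] [_ Qprim] QS S1 Ss Ls.
have nQS x : Q x -> S x -> False by move=> Qx Sx; rewrite -[False]/(set0 x) -QS.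
have Lsx x : L (s * x) by rewrite mulrC; apply: LM.
split.
- apply/is_idealP; split=> [//|x y [Qx Lx] [Qy Ly]|a x [Qx Lx]].
    by split; [apply: QD | apply: LD].
  by split; [apply: QM | apply: LM].
- by move=> QT; apply: (nQS 1) => //; have [] : (Q `&` L) 1 by rewrite QT.
- by rewrite -subset0 => x [[Qx _] /(nQS _ Qx)].
exists s => // a b [/Qprim[Qa|[n n_gt0 Qbn]] _].
  by left; split; first exact: QM.
right; exists n => //; rewrite exprMn; split; first exact: QM.
by case: n n_gt0 {Qbn} => // n _; rewrite exprS -mulrA.
Qed.

Theorem theorem2p22 (R : comPzRingType) (S J : set R)
  (hS : multiplicative_set S) (hJ : is_ideal J)
  (hR : S_J_Noetherian S J) (I : set R)
  (hI : J_ideal J I) (hIproper : I <> [set: R]) (hIS : I `&` S = set0) :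
  exists (n : nat) (Q : 'I_n.+1 -> set R),
    (forall i, S_primary S (Q i)) /\
    I = \bigcap_(i in [set: 'I_n.+1]) Q i.
Proof.
have [II nIJ] := hI; have [S1 SM] := multiplicative_setP hS.
have /is_idealP[_ _ IM] := II.
have fin K : is_ideal K -> I `<=` K -> S_finite S K.
  by move=> KI IK; apply: hR; split=> // KJ; apply: nIJ => x /IK /KJ.
have satI := saturation_saturated hS II (@subset_refl _ I).
have [satI_ideal IsatI _] := satI.
have [l [lP lE]] := saturated_primary_decomposition hS fin satI.
have [s Ss sI] := saturation_sub_colon hS II (fin _ satI_ideal IsatI).
(* the empty list would give 1 in the saturation, i.e. an element of I in S *)
case: l lP lE => [|Q0 l] lP lE.
  have [t St] : saturation S I 1 by apply/lE.
  rewrite mulr1 => It.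
  by exfalso; rewrite -[False]/(set0 t) -hIS.
pose L := adjoin I s.
have IL : is_ideal L by apply: adjoin_ideal.
have Ls : L s by rewrite -[s]mulr1; apply: mem_adjoin.
have memQ (i : 'I_(size l).+1) : nth Q0 (Q0 :: l) i \in Q0 :: l.
  by apply: mem_nth; exact: ltn_ord.
exists (size l), (fun i => nth Q0 (Q0 :: l) i `&` L); split=> [i|].
  have [[QI _ Qsat] Qprim] := lP _ (memQ i).
  apply: (@S_primary_trunc _ S _ L s) => //.
  rewrite -subset0 => x [Qx Sx]; case: Qprim => + _; apply.
  by apply: (Qsat x) => //; rewrite mulr1.
rewrite eqEsubset; split=> [x Ix i _|x Qx].
  split; last exact: sub_adjoin.
  by apply: (proj1 (lE x)); [apply: IsatI | apply: memQ].
have [_ Lx] := Qx ord0 Logic.I.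
have satx : saturation S I x.
  apply/lE => Q /(nthP Q0)[i i_lt <-].
  by have [] := Qx (Ordinal i_lt) Logic.I.
apply: colon_cap_adjoin Lx => // [y|]; last exact: sI.
(* s * (s * y) in I puts y in the saturation, which s carries back into I *)
move=> Issy; apply: sI; exists (s * s); first exact: SM.
by rewrite -mulrA.
Qed.
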